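(* Let $N$ be a positive integer, let $p>2$ be a prime divisor of $N$, and let $\{q_1,\dots,q_K\}$ be the set of all positive divisors of $N$. Put $\mathfrak D_p:=\{q_i\mid N:\ p\mid q_i\text{ and }p\le q_i\}$. For $r\in\{1,2\}$ and $i\in\{1,\dots,K\}$ let $$p_i:=\begin{cases}p,& q_i\notin\mathfrak D_p,\\ r,& q_i\in\mathfrak D_p,\end{cases}$$ and consider the system $$\mathcal R^r_{p,N}:=\{L_{p_1k}c_{q_1}\}_{k=0}^{N/p_1-1}\cup\{L_{p_2k}c_{q_2}\}_{k=0}^{N/p_2-1}\cup\cdots\cup\{L_{p_Kk}c_{q_K}\}_{k=0}^{N/p_K-1}.$$ Then: (i) For $r=1$, the system $\mathcal R^1_{p,N}$ is a frame for $\ell^2(\mathbb Z_N)$ for all positive integers $N$ (having $p$ as a prime divisor). (ii) For $r=2$, if $N=2p_1'^{\,\alpha_1}p_2'^{\,\alpha_2}\cdots p_n'^{\,\alpha_n}$ with primes $p_j'\ne2$ and positive integers $\alpha_j$ for all $j\in\{1,\dots,n\}$, then $\mathcal R^2_{p,N}$ is a frame for $\ell^2(\mathbb Z_N)$.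
   Context: $\ell^2(\mathbb Z_N)$ is the $N$-dimensional complex Hilbert space of functions on $\mathbb Z_N=\{0,1,\dots,N-1\}$ (identified with $N$-periodic functions on $\mathbb Z$), with $\langle x,y\rangle=\sum_{n=0}^{N-1}x(n)\overline{y(n)}$. For $m\in\mathbb Z$, the circular shift is $L_mx(n)=x(n-m)$. For a positive integer $q$, the $q$-th Ramanujan sum is $c_q(n)=\sum_{1\le k\le q,\,(k,q)=1}e^{2\pi i kn/q}$; it is $q$-periodic, so for $q\mid N$ it is regarded as an element of $\ell^2(\mathbb Z_N)$. A finite family $(f_j)$ in a finite-dimensional Hilbert space $H$ is a frame for $H$ if there are constants $A,B>0$ with $A\|x\|^2\le\sum_j|\langle x,f_j\rangle|^2\le B\|x\|^2$ for all $x\in H$. *)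

(* Defs.v *)
From HB Require Import structures.
From mathcomp Require Import all_boot all_order all_algebra.
From mathcomp Require Import sesquilinear spectral.
From mathcomp Require Import complex.
From mathcomp Require Import reals trigo.

Set Implicit Arguments.
Unset Strict Implicit.
Unset Printing Implicit Defensive.

Import Order.TTheory GRing.Theory Num.Theory Num.Def.
Local Open Scope ring_scope.

(* [form x x] is the squared norm of [x].  In a
   [numClosedFieldType], [0 < a] forces [a] to be real. *)
Definition frame (C : numClosedFieldType) (H : vectType C)
    (form : {dot H for conjC}) (J : finType) (f : J -> H) : Prop :=
  exists A B : C, [/\ 0 < A, 0 < B &
    forall x : H,
      A * form x x <= \sum_(j : J) `|form x (f j)| ^+ 2 <= B * form x x].

Section RamanujanSystem.
Variable R : realType.

(* l2(Z_N) is ['rV[R[i]]_N] with the inner product [dotmx]. *)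
Lemma dotmx_sum N (x y : 'rV[R[i]]_N) :
  dotmx x y = \sum_(n < N) x 0 n * (y 0 n)^*%R.
Proof. by rewrite dotmxE mxE; apply: eq_bigr => n _; rewrite !mxE. Qed.

Lemma resid_subproof N (n : 'I_N) (m : int) : (`|(m %% N%:Z)%Z|%N < N)%N.
Proof.
have N0 : (0 < N)%N by apply: leq_ltn_trans (ltn_ord n).
rewrite -ltz_nat gez0_abs ?modz_ge0 ?ltz_pmod //.
by rewrite eqz_nat -lt0n.
Qed.

(* The residue of the integer [m] mod [N]; the argument [n] only witnesses
   that 'I_N is inhabited. *)
Definition resid N (n : 'I_N) (m : int) : 'I_N := Ordinal (resid_subproof n m).

Definition shift N (m : int) (x : 'rV[R[i]]_N) : 'rV[R[i]]_N :=
  \row_(n < N) x 0 (resid n (n%:Z - m)).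

Definition expi (t : R) : R[i] := Complex (cos t) (sin t).

Definition ramanujan (q : nat) (n : int) : R[i] :=
  \sum_(1 <= k < q.+1 | coprime k q) expi (2 * pi * k%:R * n%:~R / q%:R).

Definition ramanujan_vec (N q : nat) : 'rV[R[i]]_N :=
  \row_(n < N) ramanujan q n%:Z.

Definition Dset (p N : nat) : pred nat :=
  [pred q | [&& q %| N, p %| q & p <= q]%N].

Definition shift_step (p r N q : nat) : nat :=
  if q \in Dset p N then r else p.

Definition ramanujan_system (p r N K : nat) (q : 'I_K -> nat)
    (j : {i : 'I_K & 'I_(N %/ shift_step p r N (q i))}) : 'rV[R[i]]_N :=
  shift (shift_step p r N (q (tag j)) * tagged j)%N%:Z
        (ramanujan_vec N (q (tag j))).

End RamanujanSystem.

(* Main.v *)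
Require Import Defs.
From mathcomp Require Import all_boot all_order all_algebra.
From mathcomp Require Import sesquilinear spectral complex reals.
From mathcomp Require Import trigo ring lra.

(* In the orthogonal basis of characters of Z_N, c_q is the sum of the
   characters of frequency m with gcd(m, N) = N / q, and these classes
   partition Z_N as q ranges over the divisors of N.  The shifts of c_q by
   multiples of s multiply the m-th coefficient by powers of the (N/s)-th root
   of unity e^(2 pi i s m / N).  When these roots are distinct within the class
   of q, the orthogonality relations give
     sum_k |<x, L_(s k) c_q>|^2 = (N/s) sum_(m in the class of q) |x^(m)|^2,
   and summing over q yields the frame bounds N and N^2.  Distinctness amounts
   to the injectivity of k |-> s k mod q on the units mod q, which holds for s
   coprime to q, and also for s = 2 when q is twice an odd number. *)

Section RamanujanFrame.
Set Implicit Arguments.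
Unset Strict Implicit.
Unset Printing Implicit Defensive.
Import Order.TTheory GRing.Theory Num.Theory.
Local Open Scope ring_scope.

(** * Orthogonality of roots of unity *)

Lemma sum_expr_unity_root (F : idomainType) (M : nat) (w : F) :
  w ^+ M = 1 -> w != 1 -> \sum_(k < M) w ^+ k = 0.
Proof.
move=> wM w1; apply/eqP.
by have/esym/eqP := subrX1 w M; rewrite wM subrr mulf_eq0 subr_eq0 (negPf w1).
Qed.

Lemma mulr_conj_unity_root (C : numClosedFieldType) (M : nat) (w : C) :
  (0 < M)%N -> w ^+ M = 1 -> w * w^* = 1.
Proof.
move=> M0 wM; rewrite -normCK.
suff -> : `|w| = 1 by rewrite expr1n.
by apply: (pexpIrn M0); rewrite ?nnegrE // -normrX wM normr1 expr1n.
Qed.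

(** Expanding the squares gives geometric sums in the quotients of [w i] by [w j]. For [i] different
    from [j] the quotient is an [M]-th root of unity other than 1, so only the diagonal survives. *)
Lemma parseval_unity_root (C : numClosedFieldType) (J : finType) (P : pred J)
    (M : nat) (a w : J -> C) :
  (forall j, P j -> w j ^+ M = 1) -> {in P &, injective w} ->
  \sum_(k < M) `|\sum_(j | P j) a j * w j ^+ k| ^+ 2 =
  M%:R * \sum_(j | P j) `|a j| ^+ 2.
Proof.
move=> wM w_inj; have [->|M0] := posnP M; first by rewrite big_ord0 mul0r.
under eq_bigr do rewrite normCK rmorph_sum big_distrlr /=.
rewrite exchange_big /= mulr_sumr; apply: eq_bigr => i Pi.
rewrite exchange_big /= (bigD1 i) //= [X in _ + X]big1 ?addr0 => [|j /andP[Pj ji]].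
  rewrite (eq_bigr (fun=> `|a i| ^+ 2)) => [|k _].
    by rewrite sumr_const card_ord -[LHS]mulr_natl.
  by rewrite -normCK normrM exprMn [in X in _ * X]normCK rmorphXn /= -exprMn
    (mulr_conj_unity_root M0 (wM _ Pi)) expr1n mulr1.
rewrite (eq_bigr (fun k : 'I_M => a i * (a j)^* * (w i * (w j)^*) ^+ k)).
  rewrite -mulr_sumr sum_expr_unity_root ?mulr0 //.
    by rewrite exprMn wM // -rmorphXn wM // rmorph1 mulr1.
  apply: contraNneq ji => wij; apply/eqP/w_inj => //.
  rewrite -[LHS]mul1r -wij -mulrA [_^* * _]mulrC.
  by rewrite (mulr_conj_unity_root M0 (wM _ Pj)) mulr1.
by move=> k _; rewrite rmorphM rmorphXn exprMn /=; ring.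
Qed.

(** * The complex exponential and its primitive roots *)

Section Expi.
Variable R : realType.

Lemma expiD (x y : R) : expi (x + y) = expi x * expi y.
Proof. by rewrite /expi cosD sinD; congr Complex; rewrite addrC. Qed.

Lemma expi0 : expi (0 : R) = 1.
Proof. by rewrite /expi cos0 sin0. Qed.

Lemma expi_mulrn (x : R) n : expi (x *+ n) = expi x ^+ n.
Proof. by elim: n => [|n IHn]; rewrite ?mulr0n ?expi0 // mulrS expiD IHn exprS. Qed.

Lemma expi_2pi : expi (2 * pi : R) = 1.
Proof. by rewrite mulr_natl /expi cos2pi sin2pi. Qed.

(** Strictly between 0 and 2 pi the sine vanishes only at pi, where the cosine is -1. *)
Lemma expi_eq1 (x : R) : 0 < x < 2 * pi -> expi x != 1.
Proof.
move=> /andP[x0 x2]; apply/eqP => -[cx sx].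
have [xpi|xpi|xpi] := ltgtP x pi.
- by have := @sin_gt0_pi R x; rewrite x0 xpi sx ltxx => /(_ isT).
- have := @sin_gt0_pi R (x - pi); rewrite subr_gt0 xpi ltrBlDr.
  have -> : x < pi + pi by lra.
  by move=> /(_ isT); have := sinDpi (x - pi); rewrite subrK sx => /eqP;
    rewrite eq_sym oppr_eq0 => /eqP ->; rewrite ltxx.
- by move: cx; rewrite xpi cospi; lra.
Qed.

Lemma prim_expi (N : nat) : (0 < N)%N ->
  N.-primitive_root (expi (2 * pi / N%:R : R)).
Proof.
move=> N0; have N0R : (0 : R) < N%:R by rewrite ltr0n.
rewrite /primitive_root_of_unity N0; apply/forallP => i; apply/eqP.
rewrite unity_rootE -expi_mulrn -(mulr_natr (2 * pi / N%:R)).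
have [->|iN] := eqVneq i.+1 N.
  by rewrite divfK ?lt0r_neq0 // expi_2pi eqxx.
apply/negbTE/expi_eq1; have p0 := pi_gt0 R.
rewrite mulr_gt0 ?divr_gt0 ?mulr_gt0 //=.
rewrite -mulrA gtr_pMr ?mulr_gt0 // mulrC ltr_pdivrMr // mul1r ltr_nat.
by rewrite ltn_neqAle iN ltn_ord.
Qed.
End Expi.

(** Multiplication by [N %/ q] maps the units mod [q] bijectively onto the frequencies whose gcd
    with [N] is [N %/ q]. *)
Lemma sum_coprime_gcdn (V : nmodType) (N q : nat) (F : nat -> V) :
  (0 < N)%N -> (q %| N)%N -> (forall m, F (m %% N)%N = F m) ->
  \sum_(1 <= k < q.+1 | coprime k q) F (k * (N %/ q))%N =
  \sum_(m < N | N == (gcdn m N * q)%N) F m.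
Proof.
move=> N0 /dvdnP[d defN] FN.
have /andP[d0 q0] : (0 < d)%N && (0 < q)%N by rewrite -muln_gt0 -defN.
rewrite defN mulnK //.
(* Periodicity of [F] moves the endpoint [k = q] to [k = 0]; either term is present only when
   [q = 1]. *)
transitivity (\sum_(0 <= k < q | coprime k q) F (k * d)%N).
  rewrite big_mkcond [RHS]big_mkcond big_nat_recr //= [RHS]big_ltn //= addrC.
  congr (_ + _); rewrite /coprime gcdnn gcd0n mul0n -[F 0%N]FN -[F (q * d)%N]FN.
  by rewrite mod0n defN mulnC modnn.
have lt_h (k : 'I_q) : (k * d < d * q)%N by rewrite mulnC ltn_pmul2l.
have lt_h' (m : 'I_(d * q)) : (m %/ d < q)%N by rewrite ltn_divLR // (mulnC q d).
rewrite big_mkord [RHS](reindex_onto (fun k => Ordinal (lt_h k))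
  (fun m => Ordinal (lt_h' m))) /=.
  apply: eq_bigl => k; rewrite -val_eqE /= mulnK // eqxx andbT.
  rewrite (mulnC d q) -muln_gcdl -mulnA (mulnC d q) -{1}[(q * d)%N]mul1n.
  by rewrite eqn_pmul2r ?muln_gt0 ?q0 // eq_sym.
move=> m /eqP gm; apply: val_inj => /=; apply: divnK.
have gd : gcdn m (d * q) = d by apply/eqP; rewrite -(eqn_pmul2r q0) -gm.
by have := dvdn_gcdl m (d * q); rewrite gd.
Qed.

Lemma resid_mod (N : nat) (n : 'I_N) (a : nat) :
  (resid n (n%:Z - a%:Z) + a = n %[mod N])%N.
Proof.
apply/eqP; rewrite -eqz_nat -!modz_nat PoszD /= gez0_abs; last first.
  by rewrite modz_ge0 // eqz_nat -lt0n (leq_ltn_trans _ (ltn_ord n)).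
by rewrite modzDml subrK.
Qed.

(** Both residues are [g = N / d] times a number coprime to [d], so cancelling [g] turns the
    congruence mod [N] into one mod [d]. *)
Lemma modMr_gcdn_inj (N d s : nat) (m m' : 'I_N) :
  (forall k k', coprime k d -> coprime k' d ->
     k * s = k' * s %[mod d] -> k = k' %[mod d])%N ->
  N = (gcdn m N * d)%N -> N = (gcdn m' N * d)%N ->
  (m * s = m' * s %[mod N])%N -> m = m'.
Proof.
move=> s_inj; set g := gcdn m N => gm gm' smm'.
have N0 : (0 < N)%N by apply: leq_ltn_trans (ltn_ord m).
have /andP[g0 d0] : (0 < g)%N && (0 < d)%N by rewrite -muln_gt0 -gm.
have gm'E : gcdn m' N = g by apply/eqP; rewrite -(eqn_pmul2r d0) -gm -gm'.
have mul_coprime (a : nat) : gcdn a N = g -> exists2 k, a = (k * g)%N & coprime k d.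
  move=> ga; have /dvdnP[k ak] : (g %| a)%N by rewrite -ga dvdn_gcdl.
  exists k => //; rewrite /coprime -(eqn_pmul2r g0) mul1n muln_gcdl -ak.
  by rewrite [(d * g)%N]mulnC -gm ga.
have [k mk kd] := mul_coprime m erefl; have [k' mk' k'd] := mul_coprime m' gm'E.
have /s_inj kk' : (k * s = k' * s %[mod d])%N.
  apply/eqP; rewrite -(eqn_pmul2l g0) !muln_modr -gm !mulnA ![(g * _)%N]mulnC.
  by rewrite -mk -mk' smm'.
apply: val_inj; rewrite /= -(modn_small (ltn_ord m)) -(modn_small (ltn_ord m')).
by rewrite mk mk' gm ![(_ * g)%N]mulnC -!muln_modr kk'.
Qed.

(** * Fourier analysis of the shifted Ramanujan sums *)

Section RamanujanVec.
Variables (R : realType) (N : nat).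
Hypothesis N_gt0 : (0 < N)%N.
Let z : R[i] := expi (2 * pi / N%:R).
Let z_prim : N.-primitive_root z := prim_expi R N_gt0.

Let fourier (x : 'rV[R[i]]_N) (m : nat) : R[i] :=
  \sum_(n < N) x 0 n * (z ^+ (m * n))^*.

Lemma ramanujanE (q n : nat) : (q %| N)%N ->
  ramanujan R q n%:Z = \sum_(m < N | N == (gcdn m N * q)%N) z ^+ (m * n).
Proof.
move=> qN; rewrite -(@sum_coprime_gcdn _ _ _ (fun m => z ^+ (m * n))) //; last first.
  by move=> m; rewrite !exprM prim_expr_mod.
apply: eq_bigr => k _; rewrite -expi_mulrn; congr expi.
rewrite -[RHS]mulr_natr !natrM -pmulrn.
have q0 : q%:R != 0 :> R by rewrite pnatr_eq0 -lt0n (dvdn_gt0 N_gt0).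
have N0 : N%:R != 0 :> R by rewrite pnatr_eq0 -lt0n.
have -> : (N %/ q)%:R = N%:R / q%:R :> R by rewrite -{2}(divnK qN) natrM mulfK.
by field; rewrite q0 N0.
Qed.

(** The character of frequency [m] is an eigenvector of the shift by [a], with eigenvalue the
    conjugate of [z ^+ (m * a)]; the conjugation in the second argument of [dotmx] undoes this
    conjugate. *)
Lemma dotmx_shift_ramanujan (x : 'rV[R[i]]_N) (q a : nat) : (q %| N)%N ->
  dotmx x (shift a%:Z (ramanujan_vec R N q)) =
  \sum_(m < N | N == (gcdn m N * q)%N) fourier x m * z ^+ (m * a).
Proof.
move=> qN; rewrite dotmx_sum.
under eq_bigr => n _ do rewrite !mxE ramanujanE // rmorph_sum mulr_sumr.
rewrite exchange_big; apply: eq_bigr => m _.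
rewrite mulr_suml; apply: eq_bigr => n _ /=.
rewrite -mulrA; congr (_ * _).
have -> : z ^+ (m * n) = z ^+ (m * resid n (n%:Z - a%:Z)) * z ^+ (m * a).
  rewrite -exprD -mulnDr; apply/eqP; rewrite (eq_prim_root_expr z_prim).
  by rewrite -modnMmr -(resid_mod n a) modnMmr.
rewrite rmorphM -mulrA [_^* * z ^+ _]mulrC.
rewrite (@mulr_conj_unity_root _ N) ?mulr1 //.
by rewrite exprAC (prim_expr_order z_prim) expr1n.
Qed.

(** Plancherel for the unnormalised transform: in [parseval_unity_root] the frequency [m] is the
    exponent and the positions [n] index the distinct roots. *)
Lemma sum_fourier (x : 'rV[R[i]]_N) :
  \sum_(m < N) `|fourier x m| ^+ 2 = N%:R * dotmx x x.
Proof.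
rewrite dotmx_sum; under [in RHS]eq_bigr do rewrite -normCK.
rewrite -(@parseval_unity_root _ _ predT _ _ (fun n : 'I_N => (z ^+ n)^*)).
- by apply: eq_bigr => m _; congr (`|_| ^+ 2); apply: eq_bigr => n _;
    rewrite mulnC exprM rmorphXn.
- by move=> n _; rewrite -rmorphXn exprAC (prim_expr_order z_prim) expr1n rmorph1.
- move=> n n' _ _ /(can_inj conjCK)/eqP.
  by rewrite (eq_prim_root_expr z_prim) !modn_small // => /eqP/val_inj.
Qed.

(* The hypothesis on [s] says that [L_(s d)] has distinct eigenvalues on the
   characters of frequency [k / d], with [k] coprime to [d]. *)
Lemma shifted_ramanujan_frame (K : nat) (q : 'I_K -> nat) (s : nat -> nat) :
  injective q ->
  (forall d : nat, (d %| N)%N <-> exists i : 'I_K, q i = d) ->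
  (forall d, (d %| N)%N -> (s d %| N)%N) ->
  (forall d, d %| N -> forall k k', coprime k d -> coprime k' d ->
     k * s d = k' * s d %[mod d] -> k = k' %[mod d])%N ->
  frame (@dotmx R[i] N) (fun j : {i : 'I_K & 'I_(N %/ s (q i))} =>
    shift (s (q (tag j)) * tagged j)%N%:Z (ramanujan_vec R N (q (tag j)))).
Proof.
move=> q_inj qP sN s_inj; pose cls d (m : 'I_N) := N == (gcdn m N * d)%N.
have qN i : (q i %| N)%N by apply/qP; exists i.
have N0 : 0 < N%:R :> R[i] by rewrite ltr0n.
(* The classes together contribute [N] times the squared norm, and each is weighted by some
   [N %/ s d], which lies between 1 and [N]. *)
exists N%:R, (N%:R * N%:R); split=> [||x]; rewrite ?mulr_gt0 //.
have sum_cls : \sum_(i < K) \sum_(m < N | cls (q i) m) `|fourier x m| ^+ 2 =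
    N%:R * dotmx x x.
  rewrite -sum_fourier (exchange_big_dep predT) //=; apply: eq_bigr => m _.
  have g0 : (0 < gcdn m N)%N by rewrite gcdn_gt0 N_gt0 orbT.
  (* The frequency [m] lies in the class of [N %/ gcdn m N] and in no other. *)
  have /qP[i0 qi0] : (N %/ gcdn m N %| N)%N by rewrite dvdn_div ?dvdn_gcdr.
  rewrite (big_pred1 i0) // => i /=; rewrite /cls -(inj_eq q_inj) qi0.
  by rewrite eqn_div ?dvdn_gcdr // eq_sym mulnC.
have -> : \sum_(j : {i : 'I_K & 'I_(N %/ s (q i))})
      `|dotmx x (shift (s (q (tag j)) * tagged j)%N%:Z
                       (ramanujan_vec R N (q (tag j))))| ^+ 2 =
    \sum_(i < K) (N %/ s (q i))%:R *
      \sum_(m < N | cls (q i) m) `|fourier x m| ^+ 2.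
  rewrite -(@sig_big_dep _ _ _ _ _ xpredT (fun _ => xpredT) (fun i k =>
    `|dotmx x (shift (s (q i) * nat_of_ord k)%N%:Z
                     (ramanujan_vec R N (q i)))| ^+ 2)) /=.
  apply: eq_bigr => i _.
  rewrite -(@parseval_unity_root _ _ _ _ _ (fun m : 'I_N => z ^+ (m * s (q i)))).
  - apply: eq_bigr => k _; rewrite dotmx_shift_ramanujan //; congr (`|_| ^+ 2).
    by apply: eq_bigr => m _; rewrite mulnA exprM.
  - move=> m _; rewrite -exprM -mulnA [(s _ * _)%N]mulnC divnK ?sN //.
    by rewrite mulnC exprM (prim_expr_order z_prim) expr1n.
  - move=> m m'; rewrite !unfold_in => /eqP gm /eqP gm' /eqP.
    by rewrite (eq_prim_root_expr z_prim) => /eqP;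
      apply: modMr_gcdn_inj gm gm'; apply: s_inj.
rewrite -mulrA -sum_cls mulr_sumr; apply/andP; split; apply: ler_sum => i _.
  rewrite ler_peMl ?sumr_ge0 // => [m _|]; first by rewrite exprn_ge0.
  have sqN := sN _ (qN i); have sq0 := dvdn_gt0 N_gt0 sqN.
  by rewrite ler1n divn_gt0 // dvdn_leq.
rewrite ler_wpM2r ?sumr_ge0 // => [m _|]; first by rewrite exprn_ge0.
by rewrite ler_nat; apply: leq_div.
Qed.
End RamanujanVec.

Lemma eqn_modMr_coprime (d s m n : nat) : coprime d s ->
  (m * s == n * s %[mod d])%N = (m == n %[mod d])%N.
Proof.
move=> co_ds; wlog le_nm : m n / (n <= m)%N.
  move=> IH; have [/IH//|/ltnW/IH] := leqP n m.
  by rewrite !(eq_sym (n * s %% d)%N) (eq_sym (n %% d)%N).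
by rewrite !eqn_mod_dvd ?leq_mul2r ?le_nm ?orbT // -mulnBl Gauss_dvdl.
Qed.

(** For odd [d], 2 is invertible. For [d = 2e] with [e] odd, halving gives the congruence mod [e],
    while [k] and [k'] are both odd; the Chinese remainder theorem combines the two. *)
Lemma coprime_modMr2_inj (d k k' : nat) : ~~ (4 %| d)%N ->
  coprime k d -> coprime k' d ->
  (k * 2 = k' * 2 %[mod d])%N -> (k = k' %[mod d])%N.
Proof.
move=> d4 kd k'd; have [d_odd|] := boolP (odd d).
  move/eqP; rewrite eqn_modMr_coprime ?coprimen2 // => /eqP; exact.
rewrite -dvdn2 => /dvdnP[e de]; move: d4 kd k'd.
rewrite de (@dvdn_pmul2r 2 2 e) // dvdn2 negbK => e_odd.
rewrite !coprimeMr !coprimen2 => /andP[_ k_odd] /andP[_ k'_odd] /eqP.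
rewrite -!muln_modl eqn_pmul2r // => /eqP kk'.
apply/eqP; rewrite chinese_remainder ?coprimen2 // kk' eqxx /=.
by rewrite !modn2 k_odd k'_odd.
Qed.
End RamanujanFrame.

Theorem theorem2p18 (R : realType) (N p : nat) (N_gt0 : (0 < N)%N)
    (p_prime : prime p) (p_gt2 : (2 < p)%N) (p_dvd_N : (p %| N)%N)
    (K : nat) (q : 'I_K -> nat) (q_inj : injective q)
    (q_divisors : forall d : nat, (d %| N)%N <-> exists i : 'I_K, q i = d) :
  frame (@dotmx R[i] N) (@ramanujan_system R p 1 N K q)
  /\
  (forall (n : nat) (p' alpha : 'I_n -> nat),
     (forall j : 'I_n, prime (p' j) /\ p' j <> 2%N) ->
     (forall j : 'I_n, (0 < alpha j)%N) ->
     N = (2 * \prod_(j < n) p' j ^ alpha j)%N ->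
     frame (@dotmx R[i] N) (@ramanujan_system R p 2 N K q)).
Proof.
have system_frame r : (forall d, d %| N -> shift_step p r N d %| N)%N ->
    (forall d, d %| N -> p %| d -> forall k k', coprime k d -> coprime k' d ->
      k * r = k' * r %[mod d] -> k = k' %[mod d])%N ->
    frame (@dotmx R[i] N) (@ramanujan_system R p r N K q).
  move=> rN r_inj; apply: (@shifted_ramanujan_frame R N N_gt0) => // d dN k k'.
  rewrite /shift_step; case: ifPn => [/and3P[_ pd _]|]; first exact: r_inj.
  (* As [p %| d] forces [p <= d], a divisor outside [Dset p N] is coprime to its step [p]. *)
  rewrite inE dN /= => pd _ _ /eqP.
  rewrite eqn_modMr_coprime => [/eqP //|].
  rewrite coprime_sym prime_coprime //; apply: contra pd => pd.
  by rewrite pd dvdn_leq // (dvdn_gt0 N_gt0).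
split.
  apply: system_frame => [d _|d _ _ k k' _ _]; last by rewrite !muln1.
  by rewrite /shift_step; case: ifP.
move=> n p' alpha p'P _ defN; apply: system_frame => [d _|d dN _ k k'].
  by rewrite /shift_step; case: ifP => // _; rewrite defN dvdn_mulr.
(* If 4 divided [d], it would divide [N], making a product of powers of odd primes even. *)
apply: coprime_modMr2_inj; apply: contraL isT => d4.
have := dvdn_trans d4 dN; rewrite defN (@dvdn_pmul2l 2 2) // dvdn2 => /negP[].
elim/big_ind: _ => // [a b oa ob|j _]; first by rewrite oddM oa.
have [pj /eqP p2] := p'P j; rewrite oddX.
by case: (even_prime pj) p2 => [-> //|->]; rewrite orbT.
Qed.
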